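(* Let $G$ be a graph on $n$ vertices, and let $\lambda_1,\dots,\lambda_k$ be $k$ distinct nonzero purely imaginary numbers with $\operatorname{Im}\lambda_1>\operatorname{Im}\lambda_2>\dots>\operatorname{Im}\lambda_k>0$, where $2k\le n$. Then $\operatorname{match}(G)=k$ if and only if both of the following hold: (a) there is a matrix $A\in S^-(G)$ whose eigenvalues are $\pm\lambda_1,\dots,\pm\lambda_k$ together with $n-2k$ zeros; and (b) every matrix $A\in S^-(G)$ has at most $2k$ nonzero eigenvalues.
   Context: $\operatorname{match}(G)$ is the matching number of $G$ (maximum number of pairwise vertex-disjoint edges). For $G$ on vertex set $\{1,\dots,n\}$, $S^-(G)$ is the set of all $n\times n$ real skew-symmetric matrices $A=[a_{ij}]$ such that for $i\neq j$, $a_{ij}\neq0$ if and only if $\{i,j\}$ is an edge of $G$. *)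

(* Defs.v *)
From HB Require Import structures.
From mathcomp Require Import all_boot all_order all_algebra.
From mathcomp Require Import reals.
From mathcomp Require Import complex.

Set Implicit Arguments.
Unset Strict Implicit.
Unset Printing Implicit Defensive.

Import Order.TTheory GRing.Theory Num.Theory.
Local Open Scope ring_scope.

Definition simple_graph (T : finType) (e : rel T) : Prop :=
  symmetric e /\ irreflexive e.

Definition edge_set (T : finType) (e : rel T) : {set {set T}} :=
  [set [set p.1; p.2] | p : T * T & e p.1 p.2].

Definition is_matching (T : finType) (e : rel T) (M : {set {set T}}) : bool :=
  (M \subset edge_set e) && trivIset M.

Definition matching_number (T : finType) (e : rel T) : nat :=
  \max_(M : {set {set T}} | is_matching e M) #|M|.

Definition skew_class (R : realType) (n : nat) (e : rel 'I_n) (A : 'M[R]_n) :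
    Prop :=
  A^T = - A /\ (forall i j : 'I_n, i != j -> (A i j != 0 <-> e i j)).

(* The complex eigenvalues of a real matrix, repeated according to algebraic
   multiplicity: the roots of the (monic) characteristic polynomial.  The order
   of the list is unspecified, so it is only meaningful up to perm_eq. *)
Definition eigenvalues (R : realType) (n : nat) (A : 'M[R]_n) : seq R[i] :=
  sval (closed_field_poly_normal (char_poly (map_mx (real_complex R) A))).

Lemma eigenvaluesP (R : realType) (n : nat) (A : 'M[R]_n) :
  char_poly (map_mx (real_complex R) A) =
  \prod_(z <- eigenvalues A) ('X - z%:P).
Proof.
rewrite /eigenvalues; case: closed_field_poly_normal => r /= {1}->.
by rewrite (monicP (char_poly_monic _)) scale1r.
Qed.

Lemma size_eigenvalues (R : realType) (n : nat) (A : 'M[R]_n) :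
  size (eigenvalues A) = n.
Proof.
apply: succn_inj; rewrite -(size_char_poly (map_mx (real_complex R) A)).
by rewrite eigenvaluesP size_prod_XsubC.
Qed.

(* Main.v *)
(** The rank of a skew-symmetric matrix is the size of a nonsingular principal
submatrix, and a nonsingular skew-symmetric submatrix on [S] forces a perfect
matching of the graph on [S]: some neighbour [j] of a given vertex [i] can be
deleted together with [i] without losing nonsingularity.  Hence every matrix of
the class has at most [2 * matching_number e] nonzero eigenvalues.

Conversely fix a maximum matching.  Put weights [t_m] on its edges and weights
[+eps] or [-eps] on all other edges.  For [eps = 0] the spectrum is
[+- i t_m] and zeros, and the Jacobian in [t] of the equations
[det (mu_j + i A) = 0] at [t = mu] is diagonal and invertible because the [mu_j]
are distinct.  A contraction argument then solves these equations for some small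
[eps <> 0], and the rank bound forces the remaining eigenvalues to vanish. *)

Require Import Defs.
From HB Require Import structures.
From mathcomp Require Import all_boot all_order all_algebra.
From mathcomp Require Import reals.
From mathcomp Require Import complex.

Set Implicit Arguments.
Unset Strict Implicit.
Unset Printing Implicit Defensive.

Import Order.TTheory GRing.Theory Num.Theory.
Local Open Scope ring_scope.

(** * Nonsingular principal submatrices of skew-symmetric matrices *)

Section SkewMatchings.
Variables (F : numFieldType) (n : nat) (A : 'M[F]_n).
Implicit Types (S : {set 'I_n}) (w r : 'rV[F]_n).

(** Row vectors supported on [S] stand for vectors indexed by [S], so that vertices can be deleted
    from [S] without reindexing the matrix. *)
Definition principal_nonsingular S :=
  forall w, (forall u, u \notin S -> w 0 u = 0) ->
    (forall v, v \in S -> (w *m A) 0 v = 0) -> w = 0.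

(** The vector [r] is row [x] of the inverse of the principal submatrix on [S], extended by zero. *)
Lemma principal_dual_basis S x : principal_nonsingular S -> x \in S ->
  exists2 r : 'rV[F]_n, (forall u, u \notin S -> r 0 u = 0) &
    (forall v, v \in S -> (r *m A) 0 v = (x == v)%:R).
Proof.
move=> nsS xS.
(* Padding with the identity outside [S] gives a full-size matrix, block diagonal up to reordering,
   that is invertible exactly when the submatrix on [S] is. *)
pose AS := \matrix_(u, v)
  (if (u \in S) && (v \in S) then A u v else (u == v)%:R) : 'M[F]_n.
have outE (w : 'rV_n) v : v \notin S -> (w *m AS) 0 v = w 0 v.
  move=> vS; rewrite mxE (bigD1 v) //= big1 ?addr0 => [|u uv].
    by rewrite mxE (negPf vS) andbF eqxx mulr1.
  by rewrite mxE (negPf vS) andbF (negPf uv) mulr0.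
have inE' (w : 'rV_n) v : (forall u, u \notin S -> w 0 u = 0) -> v \in S ->
    (w *m AS) 0 v = (w *m A) 0 v.
  move=> w0 vS; rewrite !mxE; apply: eq_bigr => u _; rewrite mxE vS andbT.
  by case: ifPn => // /w0 ->; rewrite !mul0r.
have ASu : AS \in unitmx.
  rewrite -row_free_unit -kermx_eq0; apply/eqP/row_matrixP => i; rewrite row0.
  have kerA : row i (kermx AS) *m AS = 0.
    by apply/eqP; rewrite -sub_kermx row_sub.
  have out0 u : u \notin S -> (row i (kermx AS)) 0 u = 0.
    by move=> uS; rewrite -outE // kerA mxE.
  by apply: nsS => // v vS; rewrite -inE' // kerA mxE.
pose r := delta_mx 0 x *m invmx AS : 'rV_n.
have rE v : (r *m AS) 0 v = (x == v)%:R.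
  by rewrite mulmxKV // mxE eqxx eq_sym.
have r0 u : u \notin S -> r 0 u = 0.
  move=> uS; rewrite -outE // rE; case: eqP => // xu.
  by rewrite -xu xS in uS.
by exists r => // v vS; rewrite -inE' // rE.
Qed.

Hypothesis skewA : A^T = - A.

Lemma skewE i j : A i j = - A j i.
Proof. by have /matrixP/(_ j i) := skewA; rewrite !mxE. Qed.

Lemma skew_diag0 i : A i i = 0.
Proof. by have /eqP := skewE i i; rewrite -addr_eq0 -mulr2n mulrn_eq0 => /eqP. Qed.

Lemma skew_pairing w r : (w *m A *m r^T) 0 0 = - (r *m A *m w^T) 0 0.
Proof.
rewrite -[w *m A *m r^T]trmxK [LHS]mxE !trmx_mul trmxK skewA mulNmx mulmxN mulmxA.
by rewrite mxE.
Qed.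

Lemma mul_trE w r : (w *m A *m r^T) 0 0 = \sum_v (w *m A) 0 v * r 0 v.
Proof. by rewrite mxE; apply: eq_bigr => v _; rewrite [r^T _ _]mxE. Qed.

(* The entries [r i j] of the inverse of the principal submatrix detect, by
   Jacobi's complementary minor identity, whether deleting [i] and [j] keeps it
   nonsingular; expanding [(r *m A) i i = 1] gives such a [j] next to [i]. *)
Lemma principal_nonsingular_shrink S i : principal_nonsingular S -> i \in S ->
  exists j, [/\ j \in S :\ i, A i j != 0 & principal_nonsingular (S :\ i :\ j)].
Proof.
move=> nsS iS; have [r r0 rA] := principal_dual_basis nsS iS.
(* Pairing the dual vector of [x] with a vector supported on [S] reads off coordinate [x]. Combined
   with [skew_pairing] it shows that the inverse is skew as well, which gives [ri], [sj] and [sr]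
   below. *)
have pairing x (s t : 'rV_n) : x \in S ->
    (forall v, v \in S -> (s *m A) 0 v = (x == v)%:R) ->
    (forall u, u \notin S -> t 0 u = 0) ->
    (s *m A *m t^T) 0 0 = t 0 x.
  move=> xS sA t0; rewrite mul_trE (bigD1 x) //= sA // eqxx mul1r big1 ?addr0 //.
  move=> v vx; case: (boolP (v \in S)) => [vS|/t0 ->]; last by rewrite mulr0.
  by rewrite sA // eq_sym (negPf vx) mul0r.
have /existsP [j /andP [rj Aji]] : [exists j, (r 0 j != 0) && (A j i != 0)].
  apply: contraT; rewrite negb_exists => /forallP none.
  have := rA i iS; rewrite eqxx mxE big1 => [/esym/eqP|j _]; first by rewrite oner_eq0.
  by apply/eqP; rewrite mulf_eq0; have := none j; rewrite negb_and !negbK.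
have jS : j \in S by apply: contraNT rj => /r0 ->.
have ji : j != i by apply: contraNneq Aji => ->; rewrite skew_diag0.
have [s s0 sA] := principal_dual_basis nsS jS.
have ri : r 0 i = 0.
  have := skew_pairing r r; rewrite (pairing i) // => /eqP.
  by rewrite -addr_eq0 -mulr2n mulrn_eq0 => /eqP.
have sj : s 0 j = 0.
  have := skew_pairing s s; rewrite (pairing j) // => /eqP.
  by rewrite -addr_eq0 -mulr2n mulrn_eq0 => /eqP.
have sr : s 0 i = - r 0 j.
  by have := skew_pairing r s; rewrite (pairing i) // (pairing j).
exists j; split; first by rewrite !inE ji.
  by rewrite skewE oppr_eq0.
move=> w w0 wA.
(* On [S], the product [w *m A] can be nonzero only at [i] and [j], so [w] is a combination of the
   two dual vectors. Its coordinates at [i] and [j] vanish while [r 0 j] does not, which kills both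
   coefficients. *)
have wE : w = (w *m A) 0 i *: r + (w *m A) 0 j *: s.
  apply/eqP; rewrite -subr_eq0; apply/eqP/nsS => [u uS|v vS].
    have wu0 : w 0 u = 0 by apply: w0; rewrite !inE (negPf uS) !andbF.
    by rewrite !mxE wu0 r0 // s0 // !mulr0 addr0 subrr.
  rewrite mulmxBl mulmxDl -!scalemxAl; move: (rA v vS) (sA v vS) (wA v).
  rewrite !mxE => -> ->; rewrite !inE vS andbT.
  have [-> _|vi] := eqVneq v i.
    by rewrite (negPf ji) mulr1 mulr0 addr0 subrr.
  have [-> _|vj -> //] := eqVneq v j; first by rewrite mulr1 mulr0 add0r subrr.
  by rewrite !mulr0 addr0 subrr.
have wi : w 0 i = 0 by apply: w0; rewrite !inE eqxx andbF.
have wj : w 0 j = 0 by apply: w0; rewrite !inE eqxx.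
have b0 : (w *m A) 0 j = 0.
  move: (congr1 (fun m : 'rV_n => m 0 i) wE); rewrite wi [RHS]mxE.
  rewrite [X in _ = X + _]mxE [X in _ = _ + X]mxE ri sr mulr0 add0r mulrN.
  by move/esym/eqP; rewrite oppr_eq0 mulf_eq0 (negPf rj) orbF => /eqP.
have a0 : (w *m A) 0 i = 0.
  move: (congr1 (fun m : 'rV_n => m 0 j) wE); rewrite wj [RHS]mxE.
  rewrite [X in _ = X + _]mxE [X in _ = _ + X]mxE sj mulr0 addr0.
  by move/esym/eqP; rewrite mulf_eq0 (negPf rj) orbF => /eqP.
by rewrite wE a0 b0 !scale0r addr0.
Qed.

(** Take [S] to index a basis of the rows of [A]. By skewness the columns in [S] span all columns,
    so a vector supported on [S] that annihilates them annihilates [A], and independence of the rows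
    makes it zero. *)
Lemma principal_nonsingular_rank :
  exists2 S : {set 'I_n}, #|S| = \rank A & principal_nonsingular S.
Proof.
pose f := maxrankfun A; pose B := rowsub f A.
exists [set f i | i : 'I_(\rank A)].
  by rewrite card_imset ?card_ord //; apply: maxrankfun_inj.
move=> w w0 wA.
have /submxP [X AX] : (A <= B)%MS by rewrite eq_maxrowsub.
have wBT : w *m B^T = 0.
  apply/rowP => m; rewrite mxE [RHS]mxE.
  under eq_bigr do rewrite !mxE skewE mulrN.
  rewrite sumrN; have := wA (f m) (imset_f _ isT); rewrite mxE => ->.
  by rewrite oppr0.
have wA0 : w *m A = 0.
  have /(congr1 trmx) := AX; rewrite skewA trmx_mul => /(canRL (@opprK _)) ->.
  by rewrite mulmxN mulmxA wBT mul0mx oppr0.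
pose w' := colsub f w.
have w'B : w' *m B = 0.
  rewrite -wA0; apply/rowP => v; rewrite !mxE.
  rewrite [RHS](bigID (mem [set f i | i : 'I_(\rank A)])) /=.
  rewrite [X in _ + X]big1 ?addr0 => [|u uS]; last by rewrite w0 ?mul0r.
  rewrite big_imset /=; last by move=> ? ? _ _; apply: maxrankfun_inj.
  by apply: eq_big => [i|i _]; rewrite ?mxE.
have w'0 : w' = 0.
  by apply: (row_free_inj (maxrowsub_free A)); rewrite mul0mx.
apply/rowP => u; rewrite mxE; have [|uS] := boolP (u \in [set f i | i : 'I_(\rank A)]).
  by case/imsetP => m _ ->; have /rowP/(_ m) := w'0; rewrite !mxE.
exact: w0.
Qed.

Variable e : rel 'I_n.
Hypothesis Ae : forall i j, A i j != 0 -> e i j.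

(** Induction on the size of [S]: the deleted pair is an edge by [Ae], and the inclusion of
    [cover M] in [S] is carried along to keep this edge disjoint from the matching found on the
    rest. *)
Lemma principal_nonsingular_matching S : principal_nonsingular S ->
  exists M : {set {set 'I_n}},
    [/\ is_matching e M, cover M \subset S & #|S| = (2 * #|M|)%N].
Proof.
have [m] := ubnP #|S|; elim: m S => // m IH S; rewrite ltnS => Sm nsS.
have [->|/set0Pn [i iS]] := eqVneq S set0.
  exists set0; rewrite /cover big_set0 sub0set !cards0; split=> //.
  by rewrite /is_matching sub0set /trivIset /cover !big_set0 cards0.
have [j [jS Aij nsS']] := principal_nonsingular_shrink nsS iS.
have cardS : #|S| = #|S :\ i :\ j|.+2.
  by rewrite (cardsD1 i) iS (cardsD1 j) jS.
have [|M [/andP [Me tM] cM cardM]] := IH _ _ nsS'.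
  by apply: leq_trans Sm; rewrite cardS.
have dis B : B \in M -> [disjoint [set i; j] & B].
  move=> BM; have := subset_trans (bigcup_sup B BM) cM; move/subsetP => BS.
  rewrite disjoint_sym disjoint_subset; apply/subsetP => x /BS.
  by rewrite !inE negb_or => /and3P [-> ->].
have ijM : [set i; j] \notin M.
  apply/negP => /dis; rewrite -setI_eq0 setIid => /eqP/setP/(_ i).
  by rewrite !inE eqxx.
exists ([set i; j] |: M); split.
- rewrite /is_matching; apply/andP; split.
    rewrite subUset Me andbT sub1set; apply/imsetP; exists (i, j) => //=.
    by rewrite inE /=; apply: Ae.
  apply/trivIsetP => B C; rewrite !inE.
  case/orP=> [/eqP->|BM] /orP [/eqP->|CM]; rewrite ?eqxx // => BC.
  + exact: dis.
  + by rewrite disjoint_sym dis.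
  + by move/trivIsetP: tM; apply.
- rewrite /cover big_setU1 //= subUset; apply/andP; split.
    apply/subsetP => x; rewrite !inE => /orP [] /eqP-> //.
    by move: jS; rewrite !inE => /andP [].
  apply: subset_trans cM _; apply/subsetP => x.
  by rewrite !inE => /and3P [].
- by rewrite cardsU1 ijM cardS cardM mulnDr muln1.
Qed.

Lemma skew_rank_le_matching : (\rank A <= 2 * matching_number e)%N.
Proof.
have [S <- /principal_nonsingular_matching [M [Mm _ ->]]] :=
  principal_nonsingular_rank.
by rewrite leq_mul2l /=; apply: leq_bigmax_cond.
Qed.

End SkewMatchings.

(** * Rank and the multiplicity of the eigenvalue zero *)

Lemma dvd_char_poly_rank (F : fieldType) n (A : 'M[F]_n) :
  'X^(n - \rank A) %| char_poly A.
Proof.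
set r := \rank A.
(* Write [A] as [P *m pid_mx r *m Q] with [P], [Q] invertible, so that ['X - A] becomes
   [P *m ('X *: W - pid_mx r) *m Q]. The rows of the middle factor from index [r] on are multiples
   of ['X]; [D] collects these factors and [N] is what remains. *)
pose W := invmx (col_ebase A) *m invmx (row_ebase A).
pose D : 'rV[{poly F}]_n := \row_i (if (i < r)%N then 1 else 'X).
pose N : 'M[{poly F}]_n := \matrix_(i, j)
  (if (i < r)%N then 'X * (W i j)%:P - (i == j)%:R else (W i j)%:P).
have E : char_poly_mx A = map_mx polyC (col_ebase A) *m (diag_mx D *m N) *m
    map_mx polyC (row_ebase A).
  have -> : diag_mx D *m N = 'X *: map_mx polyC W - map_mx polyC (pid_mx r).
    apply/matrixP => i j; rewrite mul_diag_mx !mxE.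
    case: ifP => ir; first by rewrite mul1r andbT polyC_natr.
    by rewrite andbF polyC0 subr0.
  rewrite mulmxBr mulmxBl -scalemxAr -scalemxAl -!map_mxM mulmx_ebase.
  rewrite /W mulmxA mulmxV ?col_ebase_unit // mul1mx mulVmx ?row_ebase_unit //.
  by rewrite map_mx1 scalemx1.
rewrite /char_poly E !det_mulmx det_diag.
apply: dvdp_mulr; apply: dvdp_mull; apply: dvdp_mulr.
rewrite (bigID (fun i : 'I_n => (i < r)%N)) /= dvdp_mull //.
have -> : \prod_(i < n | ~~ (i < r)%N) D 0 i = 'X^(n - r).
  rewrite (eq_bigr (fun=> 'X)) => [|i /negPf ir]; last by rewrite mxE ir.
  rewrite prodr_const; congr (_ ^+ _).
  have cardr : #|[pred i : 'I_n | (i < r)%N]| = r.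
    rewrite -[RHS]card_ord -!sum1_card.
    by rewrite [RHS](big_ord_widen n (fun=> 1%N) (rank_leq_row A)).
  have := cardC [pred i : 'I_n | (i < r)%N]; rewrite card_ord cardr => cE.
  by rewrite -[in RHS]cE addKn.
exact: dvdpp.
Qed.

Section EigenvalueCounts.
Variables (R : realType) (n : nat) (A : 'M[R]_n).

Lemma count0_eigenvalues : (n - \rank A <= count_mem 0%R (eigenvalues A))%N.
Proof.
rewrite -mu_prod_XsubC -eigenvaluesP mup_geq ?subr0; last first.
  by rewrite monic_neq0 // char_poly_monic.
by have := dvd_char_poly_rank (map_mx (real_complex R) A); rewrite mxrank_map.
Qed.

Lemma count_neq0_eigenvalues :
  (count (fun z : R[i] => z != 0%R) (eigenvalues A) <= \rank A)%N.
Proof.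
have := count_predC (pred1 (0 : R[i])) (eigenvalues A); rewrite size_eigenvalues => E.
rewrite -(leq_add2l (count (pred1 (0 : R[i])) (eigenvalues A))) E.
by rewrite addnC -leq_subLR count0_eigenvalues.
Qed.

Lemma mem_eigenvalues z :
  (z \in eigenvalues A) = root (char_poly (map_mx (real_complex R) A)) z.
Proof. by rewrite eigenvaluesP root_prod_XsubC. Qed.

(** At most [\rank A] eigenvalues are nonzero, counted with multiplicity. The distinct elements of
    [s] already use up this allowance, so each is simple and nothing but zeros is left. *)
Lemma perm_eigenvalues (s : seq R[i]) : uniq s -> 0 \notin s ->
  {subset s <= eigenvalues A} -> (\rank A <= size s)%N ->
  perm_eq (eigenvalues A) (s ++ nseq (n - size s) 0).
Proof.
move=> us s0 sE rs.
pose E := eigenvalues A; pose E' := filter (predC (pred1 (0 : R[i]))) E.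
have sE' : {subset s <= E'}.
  move=> z zs; rewrite mem_filter sE // andbT /=.
  by apply: contraNneq s0 => <-.
have szE' : (size E' <= size s)%N.
  by rewrite size_filter; apply: leq_trans count_neq0_eigenvalues rs.
have szEq : size E' = size s.
  by apply/eqP; rewrite eqn_leq szE' uniq_leq_size.
have sub : s =i E' by apply: (uniq_min_size us sE' szE').2.
have pE' : perm_eq E' s.
  by apply: uniq_perm => //; apply: leq_size_uniq sE' szE'.
have pE0 : filter (pred1 (0 : R[i])) E = nseq (n - size s) 0.
  have /all_pred1P -> : all (pred1 (0 : R[i])) (filter (pred1 (0 : R[i])) E) by apply: filter_all.
  congr nseq; have := count_predC (pred1 (0 : R[i])) E; rewrite size_eigenvalues.
  by rewrite -!size_filter -/E' szEq => <-; rewrite addnK.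
rewrite -pE0 perm_sym perm_catC perm_sym.
by rewrite -(perm_filterC (pred1 (0 : R[i])) (eigenvalues A)) perm_cat2l.
Qed.

End EigenvalueCounts.

(** * An oriented maximum matching and the bound on nonzero eigenvalues *)

Lemma matching_enum n (e : rel 'I_n) : irreflexive e ->
  exists a b : 'I_(matching_number e) -> 'I_n,
    [/\ injective a, injective b, forall m m', a m != b m' &
        forall m, e (a m) (b m)].
Proof.
move=> irr.
have [M Mm cardM] : exists2 M, is_matching e M & #|M| = matching_number e.
  have [|M Mm ME] := @eq_bigmax_cond _ (is_matching e) (fun M => #|M|).
    apply/card_gt0P; exists set0; rewrite unfold_in /is_matching sub0set.
    by rewrite /trivIset /cover !big_set0 cards0.
  by exists M => //; apply/esym; exact: ME.
have /andP [/subsetP Me /trivIsetP tM] := Mm.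
rewrite -cardM.
have H (m : 'I_#|M|) : exists uv : 'I_n * 'I_n,
    e uv.1 uv.2 /\ enum_val m = [set uv.1; uv.2].
  have /Me /imsetP [uv] := enum_valP m; rewrite inE => euv ->.
  by exists uv.
have [g gP] := fin_all_exists H.
have sep (m m' : 'I_#|M|) x : x \in enum_val m -> x \in enum_val m' -> m = m'.
  move=> xm xm'; apply: contraTeq xm' => mm'.
  have dis : [disjoint enum_val m & enum_val m'].
    by apply: tM; rewrite ?enum_valP // (inj_eq enum_val_inj).
  by rewrite (disjointFr dis xm).
have ga (m : 'I_#|M|) : (g m).1 \in enum_val m by rewrite (gP m).2 !inE eqxx.
have gb (m : 'I_#|M|) : (g m).2 \in enum_val m by rewrite (gP m).2 !inE eqxx orbT.
exists (fun m => (g m).1), (fun m => (g m).2); split.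
- by move=> m m' E; apply: (sep _ _ (g m).1) => //; rewrite E.
- by move=> m m' E; apply: (sep _ _ (g m).2) => //; rewrite E.
- move=> m m'; apply/eqP => E.
  have mm' : m = m' by apply: (sep _ _ (g m).1) => //; rewrite E.
  by have := (gP m).1; rewrite E mm' irr.
- by move=> m; have [] := gP m.
Qed.

Lemma skew_class_supp (R : realType) n (e : rel 'I_n) (A : 'M[R]_n) :
  skew_class e A -> forall i j, A i j != 0 -> e i j.
Proof.
move=> [skA Ae] i j; have [->|ij] := eqVneq i j; first by rewrite skew_diag0 // eqxx.
by move/(Ae _ _ ij).
Qed.

Lemma count_neq0_eigenvalues_matching (R : realType) n (e : rel 'I_n)
    (A : 'M[R]_n) : skew_class e A ->
  (count (fun z : R[i] => z != 0%R) (eigenvalues A) <= 2 * matching_number e)%N.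
Proof.
move=> Ae; apply: leq_trans (count_neq0_eigenvalues A) _.
by apply: skew_rank_le_matching; [case: Ae|apply: skew_class_supp].
Qed.

(* Strict differentiability and solving equations by contraction *)
From mathcomp Require Import boolp classical_sets functions topology normedtype.
From mathcomp Require Import interval_inference sequences ring.

Import numFieldNormedType.Exports.
Local Open Scope classical_set_scope.

(** Makes real matrices available as a complete normed space, as [banach_fixed_point] requires. *)
HB.instance Definition _ (R : realType) (m n : nat) := Complete.on 'M[R]_(m, n).

Section RowNorm.
Variables (R : realType) (N : nat).
Implicit Type x : 'rV[R]_N.

Lemma row_norm_leP x r : 0 <= r ->
  (`|x| <= r <-> forall m, `|x 0 m| <= r).
Proof.
move=> r0; rewrite [`|x|]mx_normrE; split=> [/bigmax_leP [_ xr] m|xr].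
  exact: (xr (0, m)).
by apply/bigmax_leP; split=> // -[i j] _; rewrite ord1.
Qed.

Lemma row_norm_ge x m : `|x 0 m| <= `|x|.
Proof. exact: (proj1 (row_norm_leP x (normr_ge0 x)) (lexx _)). Qed.

End RowNorm.

Section Hadamard.
Variables (R : realType) (N : nat).
Local Notation V := 'rV[R]_N.

(* Hadamard's lemma as a definition: strict differentiability with no estimates,
   the partial derivatives at [p] being [phi m (p, p)]. *)
Definition hadamard (f : V -> R) :=
  continuous f /\ exists2 phi : 'I_N -> V * V -> R,
    (forall m, continuous (phi m)) &
    (forall x y, f x - f y = \sum_m phi m (x, y) * (x 0 m - y 0 m)).

Lemma hadamard_cst c : hadamard (fun=> c).
Proof.
split; first exact: cst_continuous.
exists (fun=> fun=> 0) => [m|x y]; first exact: cst_continuous.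
by rewrite subrr big1 // => m _; rewrite mul0r.
Qed.

Lemma hadamard_coord l : hadamard (fun x => x 0 l).
Proof.
split; first exact: coord_continuous.
exists (fun m => fun=> (m == l)%:R) => [m|x y]; first exact: cst_continuous.
rewrite (bigD1 l) //= eqxx mul1r big1 ?addr0 // => m /negPf ->.
by rewrite mul0r.
Qed.

Lemma hadamardD f g : hadamard f -> hadamard g ->
  hadamard (fun x => f x + g x).
Proof.
move=> [cf [phi cphi fE]] [cg [psi cpsi gE]]; split.
  by move=> x; exact: (cvgD (cf x) (cg x)).
exists (fun m z => phi m z + psi m z) => [m z|x y].
  exact: (cvgD (cphi m z) (cpsi m z)).
have -> : f x + g x - (f y + g y) = (f x - f y) + (g x - g y) by ring.
by rewrite fE gE -big_split; apply: eq_bigr => m _; rewrite mulrDl.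
Qed.

Lemma hadamardM f g : hadamard f -> hadamard g ->
  hadamard (fun x => f x * g x).
Proof.
move=> [cf [phi cphi fE]] [cg [psi cpsi gE]]; split.
  by move=> x; exact: (cvgM (cf x) (cg x)).
exists (fun m z => f z.1 * psi m z + phi m z * g z.2) => [m z|x y].
  have cf1 : f z'.1 @[z' --> z] --> f z.1.
    exact: (cvg_comp _ _ (@cvg_fst _ _ (nbhs z.1) (nbhs z.2) _) (cf z.1)).
  have cg2 : g z'.2 @[z' --> z] --> g z.2.
    exact: (cvg_comp _ _ (@cvg_snd _ _ (nbhs z.1) (nbhs z.2) _) (cg z.2)).
  exact: (cvgD (cvgM cf1 (cpsi m z)) (cvgM (cphi m z) cg2)).
have -> : f x * g x - f y * g y = f x * (g x - g y) + (f x - f y) * g y by ring.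
rewrite fE gE mulr_sumr mulr_suml -big_split; apply: eq_bigr => m _ /=; ring.
Qed.

End Hadamard.

(* Newton's iteration [x_j - f_j x / c_j], with the coordinate [0] frozen at a
   value slightly off [p], is a contraction near [p]. *)
Lemma hadamard_solve (R : realType) k (f : 'I_k -> 'rV[R]_k.+1 -> R)
    (phi : 'I_k -> 'I_k.+1 -> 'rV[R]_k.+1 * 'rV[R]_k.+1 -> R)
    (p : 'rV[R]_k.+1) (c : 'I_k -> R) (d : R) :
  (forall j m, continuous (phi j m)) ->
  (forall j x y, f j x - f j y = \sum_m phi j m (x, y) * (x 0 m - y 0 m)) ->
  (forall j, f j p = 0) -> (forall j, c j != 0) ->
  (forall j m, phi j (lift ord0 m) (p, p) = c j * (m == j)%:R) -> 0 < d ->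
  exists x : 'rV[R]_k.+1,
    [/\ forall m, `|x 0 m - p 0 m| <= d, x 0 ord0 != p 0 ord0 &
        forall j, f j x = 0].
Proof.
move=> cphi fE fp c0 phip d0.
(* There are [k] error terms of size at most [eta], so they sum to at most one half; [k.+1] keeps
   the denominator nonzero when [k] is 0. *)
pose eta : R := (2 * k.+1%:R)^-1.
have eta0 : 0 < eta by rewrite invr_gt0 mulr_gt0.
pose B : R := \sum_j `|phi j ord0 (p, p) / c j| + 1.
have B0 : 0 < B by rewrite ltr_wpDl // sumr_ge0.
have nearL : \forall z \near (p, p), forall jm : 'I_k * 'I_k,
    `|phi jm.1 (lift ord0 jm.2) z / c jm.1 - (jm.2 == jm.1)%:R| < eta.
  apply: (@filter_forall _ _ (fun (jm : 'I_k * 'I_k) z =>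
    `|phi jm.1 (lift ord0 jm.2) z / c jm.1 - (jm.2 == jm.1)%:R| < eta)
    (nbhs (p, p))) => -[j m] /=.
  have : phi j (lift ord0 m) z / c j @[z --> (p, p)] --> ((m == j)%:R : R).
    have -> : (m == j)%:R = phi j (lift ord0 m) (p, p) / c j.
      by rewrite phip mulrAC mulfV ?mul1r.
    by apply: (cvgM (cphi _ _ _) (cvg_cst _)).
  by move/cvgrPdist_lt => /(_ _ eta0); apply: filterS => z; rewrite distrC.
have near0 : \forall z \near (p, p), forall j : 'I_k,
    `|phi j ord0 z / c j| < B.
  apply: (@filter_forall _ _ (fun j z => `|phi j ord0 z / c j| < B)
    (nbhs (p, p))) => j.
  have : phi j ord0 z / c j @[z --> (p, p)] --> phi j ord0 (p, p) / c j.
    by apply: (cvgM (cphi _ _ _) (cvg_cst _)).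
  move/cvgrPdist_lt => /(_ _ ltr01); apply: filterS => z zlt.
  have := ler_normD (phi j ord0 (p, p) / c j)
    (phi j ord0 z / c j - phi j ord0 (p, p) / c j).
  rewrite addrC subrK => /le_lt_trans; apply.
  rewrite distrC in zlt; rewrite /B ler_ltD //.
  by rewrite (bigD1 j) //= lerDl sumr_ge0.
have [r0 /= r00 ballr] :=
  proj1 (nbhs_ballP (p, p) _) (@filterI _ (nbhs (p, p)) _ _ _ nearL near0).
(* Halving [r0] puts the closed ball of radius [r] inside the open ball of radius [r0]. *)
pose r := Num.min (r0 / 2) d.
have r_gt0 : 0 < r by rewrite lt_min divr_gt0.
have rd : r <= d by rewrite ge_min lexx orbT.
have inball (x : 'rV[R]_k.+1) : `|x - p| <= r -> ball p r0 x.
  move=> xr; rewrite -ball_normE /= distrC (le_lt_trans xr) //.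
  by rewrite gt_min ltr_pdivrMr // ltr_pMr // ltr1n.
have good x y : `|x - p| <= r -> `|y - p| <= r ->
    (forall j m, `|phi j (lift ord0 m) (x, y) / c j - (m == j)%:R| <= eta) /\
    (forall j, `|phi j ord0 (x, y) / c j| <= B).
  move=> xr yr; have [H1 H2] := ballr (x, y) (conj (inball _ xr) (inball _ yr)).
  by split=> [j m|j]; apply/ltW; [apply: (H1 (j, m))|apply: H2].
(* The shift of coordinate 0, chosen so that a Newton step from the shifted base point moves by at
   most [r / 2]. *)
pose eps := Num.min r (r / (2 * B)).
have eps0 : 0 < eps by rewrite lt_min r_gt0 divr_gt0 // mulr_gt0.
have epsr : eps <= r by rewrite ge_min lexx.
have epsB : B * eps <= r / 2.
  rewrite mulrC -ler_pdivlMr // -mulrA -invfM.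
  by rewrite ge_min lexx orbT.
pose F (x : 'rV[R]_k.+1) : 'rV[R]_k.+1 :=
  \row_i (if unlift ord0 i is Some j then x 0 i - f j x / c j else x 0 i).
pose U : set 'rV[R]_k.+1 :=
  [set x | `|x - p| <= r /\ x 0 ord0 = p 0 ord0 + eps].
have F0 x : F x 0 ord0 = x 0 ord0 by rewrite mxE unlift_none.
have FS x j : F x 0 (lift ord0 j) = x 0 (lift ord0 j) - f j x / c j.
  by rewrite mxE liftK.
have Flip x y : U x -> U y -> `|F x - F y| <= 2^-1 * `|x - y|.
  move=> [xr x0] [yr y0]; have [phiL _] := good x y xr yr.
  apply/row_norm_leP => [|i]; first by rewrite mulr_ge0 // invr_ge0.
  case: (unliftP ord0 i) => [j ->|->]; last first.
    rewrite mxE [(- F y) _ _]mxE !F0 x0 y0 subrr normr0.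
    by rewrite mulr_ge0 ?invr_ge0.
  (* Points of [U] share coordinate 0, so that term of Hadamard's sum drops out and only
     coefficients bounded by [eta] remain. *)
  have -> : (F x - F y) 0 (lift ord0 j) =
      \sum_m ((m == j)%:R - phi j (lift ord0 m) (x, y) / c j) *
        (x - y) 0 (lift ord0 m).
    rewrite mxE [(- F y) _ _]mxE !FS.
    have -> : x 0 (lift ord0 j) - f j x / c j - (y 0 (lift ord0 j) - f j y / c j)
      = (x 0 (lift ord0 j) - y 0 (lift ord0 j)) - (f j x - f j y) / c j by ring.
    rewrite fE big_ord_recl /= x0 y0 subrr mulr0 add0r mulr_suml.
    under [RHS]eq_bigr do rewrite mulrBl.
    rewrite sumrB; congr (_ - _).
      rewrite (bigD1 j) //= eqxx mul1r big1 ?addr0 ?mxE // => m /negPf ->.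
      by rewrite mul0r.
    by apply: eq_bigr => m _; rewrite !mxE mulrAC.
  apply: le_trans (ler_norm_sum _ _ _) _.
  apply: (@le_trans _ _ (\sum_(m < k) eta * `|x - y|)).
    apply: ler_sum => m _; rewrite normrM; apply: ler_pM => //.
      by rewrite distrC phiL.
    exact: row_norm_ge.
  rewrite sumr_const card_ord -mulrnAl ler_wpM2r //.
  rewrite /eta -[_ *+ k]mulr_natr invfM -mulrA ger_pMr ?invr_gt0 //.
  by rewrite mulrC ler_pdivrMr // mul1r ler_nat.
pose q : 'rV[R]_k.+1 := \row_i (p 0 i + (i == ord0)%:R * eps).
have Uq : U q.
  split; last by rewrite mxE eqxx mul1r.
  apply/row_norm_leP => [|i]; first exact: ltW.
  rewrite !mxE addrAC subrr add0r.
  case: eqP => _; last by rewrite mul0r normr0 ltW.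
  by rewrite mul1r gtr0_norm.
(* The displacement is split through [F q]: the contraction accounts for at most [r / 2], and the
   Newton step at [q], of size at most [B * eps], for the other half. *)
have FU : set_fun U U F.
  move=> x Ux; have [xr x0] := Ux; split; last by rewrite F0.
  apply/row_norm_leP => [|i]; first exact: ltW.
  case: (unliftP ord0 i) => [j ->|->]; last first.
    by rewrite mxE F0 [(- p) _ _]mxE x0 addrAC subrr add0r gtr0_norm.
  have pq : (- p) 0 (lift ord0 j) = - q 0 (lift ord0 j).
    by rewrite !mxE mul0r addr0.
  rewrite mxE pq.
  have -> : F x 0 (lift ord0 j) - q 0 (lift ord0 j) =
      (F x - F q) 0 (lift ord0 j) - f j q / c j.
    by rewrite [in RHS]mxE [(- F q) _ _]mxE (FS q); ring.
  apply: le_trans (ler_normB _ _) _.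
  have -> : r = 2^-1 * r + r / 2 by field.
  apply: lerD.
    apply: le_trans (row_norm_ge _ _) _; apply: le_trans (Flip _ _ Ux Uq) _.
    rewrite ler_wpM2l ?invr_ge0 //.
    apply/row_norm_leP => [|i']; first exact: ltW.
    case: (unliftP ord0 i') => [j' ->|->].
      apply: le_trans xr; apply: le_trans (row_norm_ge _ (lift ord0 j')).
      by rewrite !mxE mul0r addr0.
    by rewrite mxE [(- q) _ _]mxE x0 (proj2 Uq) subrr normr0 ltW.
  have pp : `|p - p| <= r by rewrite subrr normr0 ltW.
  have [_ phi0] := good q p (proj1 Uq) pp.
  have -> : f j q = phi j ord0 (q, p) * eps.
    rewrite -[LHS]subr0 -(fp j) fE big_ord_recl /= big1 ?addr0 => [|m _].
      by rewrite mxE eqxx mul1r addrAC subrr add0r.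
    by rewrite mxE mul0r addr0 subrr mulr0.
  rewrite mulrAC normrM (gtr0_norm eps0); apply: le_trans epsB.
  by apply: ler_wpM2r; [exact: ltW|exact: phi0].
have closedU : closed U.
  apply: closedI.
    have -> : (fun x : 'rV[R]_k.+1 => is_true (`|x - p| <= r)) = closed_ball p r.
      rewrite closed_ballE //; apply/funext => x.
      by rewrite /closed_ball_ /= distrC.
    exact: closed_ball_closed.
  apply: (@preimage_closed 'rV[R]_k.+1 R (fun x => x 0 ord0)
    [set y | y = p 0 ord0 + eps]); last exact: closed_eq.
  by move=> x _; apply: coord_continuous.
have [||x [xr x0] xE] := @banach_fixed_point R _ U (mkfun FU) _ closedU.
- exists (2^-1)%:nng; split=> /=; first by rewrite invf_lt1 // ltr1n.
  by move=> [y z] [/= Uy Uz]; apply: Flip.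
- by exists q.
exists x; split=> [m||j].
- apply: le_trans rd; apply: le_trans xr.
  by have := row_norm_ge (x - p) m; rewrite !mxE.
- by rewrite x0 -subr_eq0 addrAC subrr add0r gt_eqF.
- have := FS x j; rewrite -[F x]/(mkfun FU x) -xE => /eqP.
  rewrite -subr_eq0 opprB addrC subrK mulf_eq0 invr_eq0 (negPf (c0 j)) orbF.
  by move/eqP.
Qed.

(** Allows an identity obtained by cancelling [h], hence only for nonzero [h], to be evaluated at
    0. *)
Lemma punctured_zero (R : realType) (g : R -> R) :
  {for 0, continuous g} -> (forall h, h != 0 -> g h = 0) -> g 0 = 0.
Proof.
move=> cg g0; apply/eqP; apply: contraT => gn0.
have /cvgrPdist_lt /(_ `|g 0|) := cg; rewrite normr_gt0 => /(_ gn0).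
move/nbhs_ballP => [r /= r0 /(_ (r / 2))].
have r2 : 0 < r / 2 by rewrite divr_gt0.
rewrite (g0 (r / 2)) ?gt_eqF //= subr0 ltxx => contra; apply: contra.
by rewrite -ball_normE /= sub0r normrN gtr0_norm // ltr_pdivrMr // ltr_pMr // ltr1n.
Qed.

(* Squaring the difference quotient avoids the sign of the square root when only
   [f ^ 2] is known along the line. *)
Lemma hadamard_sqr_slope (R : realType) N (f : 'rV[R]_N -> R)
    (phi : 'I_N -> 'rV[R]_N * 'rV[R]_N -> R) (p : 'rV[R]_N) m (g : R -> R) :
  continuous (phi m) ->
  (forall x y, f x - f y = \sum_m phi m (x, y) * (x 0 m - y 0 m)) ->
  f p = 0 -> {for 0, continuous g} ->
  (forall h, f (p + h *: delta_mx 0 m) ^+ 2 = h ^+ 2 * g h) ->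
  phi m (p, p) ^+ 2 = g 0.
Proof.
move=> cphi fE fp cg sq.
pose D (h : R) := phi m (p + h *: delta_mx 0 m, p) ^+ 2 - g h.
suff : D 0 = 0 by rewrite /D scale0r addr0 => /eqP; rewrite subr_eq0 => /eqP.
apply: punctured_zero => [|h h0].
  have cl : {for 0, continuous (fun h : R => p + h *: (delta_mx 0 m : 'rV[R]_N))}.
    apply: (@cvgD _ _ _ (nbhs (0 : R))); first exact: cvg_cst.
    apply: cvgZ; [exact: cvg_id|exact: cvg_cst].
  have cp : (fun h : R => (p + h *: (delta_mx 0 m : 'rV[R]_N), p)) h @[h --> (0 : R)] -->
      (p + 0 *: (delta_mx 0 m : 'rV[R]_N), p).
    exact: (cvg_pair cl (cvg_cst p)).
  have cphi0 := cvg_comp _ _ cp (cphi _).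
  exact: (cvgB (cvgM cphi0 cphi0) cg).
apply/eqP; rewrite subr_eq0; apply/eqP.
apply: (mulfI (expf_neq0 2 h0)); rewrite -sq -exprMn -[f _]subr0 -fp fE.
rewrite (bigD1 m) //= big1 => [|l lm]; rewrite !mxE eqxx /=.
  by rewrite eqxx mulr1 addr0 [p 0 m + h]addrC addrK [RHS]mulrC mulrC.
by rewrite (negPf lm) mulr0 addr0 subrr mulr0.
Qed.

(** * Strict differentiability of complex determinants in real parameters *)

Section ComplexHadamard.
Variables (R : realType) (N : nat).
Local Notation V := 'rV[R]_N.
Local Notation C := R[i].

Definition hadamardc (f : V -> C) :=
  hadamard (fun x => complex.Re (f x)) /\ hadamard (fun x => complex.Im (f x)).

Lemma hadamardN (f : V -> R) : hadamard f -> hadamard (fun x => - f x).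
Proof.
move=> hf; rewrite [X in hadamard X](_ : _ = (fun x => (-1) * f x)).
  by apply: hadamardM => //; apply: hadamard_cst.
by apply/funext => x; rewrite mulN1r.
Qed.

Lemma hadamardc_cst c : hadamardc (fun=> c).
Proof. by split; apply: hadamard_cst. Qed.

Lemma hadamardcD f g : hadamardc f -> hadamardc g -> hadamardc (fun x => f x + g x).
Proof.
move=> [rf jf] [rg jg]; split.
  rewrite [X in hadamard X](_ : _ = (fun x => complex.Re (f x) + complex.Re (g x))).
    exact: hadamardD.
  by apply/funext => x; case: (f x) (g x) => [? ?] [? ?].
rewrite [X in hadamard X](_ : _ = (fun x => complex.Im (f x) + complex.Im (g x))).
  exact: hadamardD.
by apply/funext => x; case: (f x) (g x) => [? ?] [? ?].
Qed.

Lemma hadamardcM f g : hadamardc f -> hadamardc g -> hadamardc (fun x => f x * g x).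
Proof.
move=> [rf jf] [rg jg]; split.
  rewrite [X in hadamard X](_ : _ = (fun x => complex.Re (f x) * complex.Re (g x) +
      - (complex.Im (f x) * complex.Im (g x)))).
    by apply: hadamardD; [|apply: hadamardN]; apply: hadamardM.
  by apply/funext => x; case: (f x) (g x) => [? ?] [? ?].
rewrite [X in hadamard X](_ : _ = (fun x => complex.Re (f x) * complex.Im (g x) +
    complex.Im (f x) * complex.Re (g x))).
  by apply: hadamardD; apply: hadamardM.
by apply/funext => x; case: (f x) (g x) => [? ?] [? ?].
Qed.

Lemma hadamardc_sum I (r : seq I) (F : I -> V -> C) :
  (forall i, hadamardc (F i)) -> hadamardc (fun x => \sum_(i <- r) F i x).
Proof.
move=> hF; elim: r => [|i r IH].
  under [X in hadamardc X]funext do rewrite big_nil; exact: hadamardc_cst.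
under [X in hadamardc X]funext do rewrite big_cons; exact: hadamardcD.
Qed.

Lemma hadamardc_prod I (r : seq I) (F : I -> V -> C) :
  (forall i, hadamardc (F i)) -> hadamardc (fun x => \prod_(i <- r) F i x).
Proof.
move=> hF; elim: r => [|i r IH].
  under [X in hadamardc X]funext do rewrite big_nil; exact: hadamardc_cst.
under [X in hadamardc X]funext do rewrite big_cons; exact: hadamardcM.
Qed.

Lemma hadamardc_det n (M : V -> 'M[C]_n) :
  (forall i j, hadamardc (fun x => M x i j)) -> hadamardc (fun x => \det (M x)).
Proof.
move=> hM; apply: hadamardc_sum => s; apply: hadamardcM.
  exact: hadamardc_cst.
exact: hadamardc_prod.
Qed.

Lemma hadamard_lin n (M : V -> 'M[R]_n) (L : 'I_N -> 'M[R]_n) i j :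
  (forall x, M x = \sum_l x 0 l *: L l) -> hadamard (fun x => M x i j).
Proof.
move=> ME.
rewrite [X in hadamard X](_ : _ = (fun x : V => \sum_l x 0 l * L l i j)); last first.
  by apply/funext => x; rewrite ME summxE; apply: eq_bigr => l _; rewrite mxE.
elim: (index_enum _) => [|l s IH].
  under [X in hadamard X]funext do rewrite big_nil; exact: hadamard_cst.
under [X in hadamard X]funext do rewrite big_cons.
apply: hadamardD => //; apply: hadamardM; last exact: hadamard_cst.
exact: hadamard_coord.
Qed.

End ComplexHadamard.

(** * The Hermitian matrix attached to a skew-symmetric matrix *)

Section Hermitian.
Variables (R : realType) (n : nat).
Local Notation rc := (real_complex R).
Implicit Type A : 'M[R]_n.

(** For skew [A] this is Hermitian with real determinant, so prescribing the eigenvalue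
    [Complex 0 mu] costs one real equation. *)
Definition herm_mx (mu : R) A : 'M[R[i]]_n :=
  (rc mu)%:M + Complex 0 1 *: map_mx rc A.

Lemma herm_mxE mu A u v : herm_mx mu A u v = Complex (mu *+ (u == v)) (A u v).
Proof.
rewrite !mxE; apply/eqP; rewrite eq_complex /=.
by case: (u == v); rewrite ?mulr1n ?mulr0n /= !mul0r !mul1r !(addr0, add0r, subr0) ?oppr0 ?addr0 !eqxx.
Qed.

Lemma tr_herm_mx mu A : A^T = - A ->
  (herm_mx mu A)^T = (rc mu)%:M - Complex 0 1 *: map_mx rc A.
Proof.
move=> skA; rewrite /herm_mx linearD /= tr_scalar_mx linearZ /= map_trmx skA.
by rewrite map_mxN scalerN.
Qed.

Lemma conj_herm_mx mu A : A^T = - A ->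
  map_mx (@conjc R) (herm_mx mu A) = (herm_mx mu A)^T.
Proof.
move=> skA; apply/matrixP => u v; rewrite mxE [RHS]mxE !herm_mxE /= eq_sym.
by congr Complex; rewrite (skewE skA) opprK.
Qed.

Lemma det_herm_real mu A : A^T = - A -> complex.Im (\det (herm_mx mu A)) = 0.
Proof.
move=> skA; have : conjc (\det (herm_mx mu A)) = \det (herm_mx mu A).
  by rewrite -det_map_mx conj_herm_mx // det_tr.
case: (\det _) => x y /= [] /esym/eqP.
by rewrite -addr_eq0 -mulr2n mulrn_eq0 => /eqP.
Qed.

(** The transpose of [mu + i A] is [mu - i A], and their product is [mu ^+ 2 + A *m A]. For a
    matching matrix this product is diagonal, so the determinant is computable up to sign. *)
Lemma det_herm_sqr mu A : A^T = - A ->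
  complex.Re (\det (herm_mx mu A)) ^+ 2 = \det ((mu ^+ 2)%:M + A *m A).
Proof.
move=> skA; have im0 := det_herm_real mu skA.
apply: (@complexI R); rewrite rmorphXn -det_map_mx /=.
have -> : rc (complex.Re (\det (herm_mx mu A))) = \det (herm_mx mu A).
  by move: im0; case: (\det _) => x y /= ->.
rewrite expr2 -{2}det_tr -det_mulmx tr_herm_mx //; congr (\det _).
rewrite map_mxD map_scalar_mx map_mxM /= /herm_mx.
rewrite mulmxDl !mulmxBr -scalar_mxM -(rmorphM (real_complex R)) -expr2 /=.
rewrite !mul_scalar_mx !mul_mx_scalar -!scalemxAl -!scalemxAr !scalerA.
by rewrite -expr2 sqr_i scaleN1r opprK addrA subrK.
Qed.

Lemma det_herm_root mu A : A^T = - A -> complex.Re (\det (herm_mx mu A)) = 0 ->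
  root (char_poly (map_mx rc A)) (Complex 0 mu) /\
  root (char_poly (map_mx rc A)) (Complex 0 (- mu)).
Proof.
move=> skA re0; have im0 := det_herm_real mu skA.
have r1 : root (char_poly (map_mx rc A)) (Complex 0 mu).
  have /eqP/det0P [v v0 vH] : \det (herm_mx mu A) = 0.
    by apply/eqP; rewrite eq_complex re0 im0 !eqxx.
  rewrite -eigenvalue_root_char; apply/eigenvalueP; exists v => //.
  move: vH; rewrite mulmxDr mul_mx_scalar -scalemxAr => /eqP.
  (* Multiplying by [- i] turns [i v A = - mu v] into the eigenvector equation [v A = i mu v]. *)
  rewrite addrC addr_eq0 => /eqP /(congr1 ( *:%R (Complex 0 (- 1)))).
  rewrite scalerA scalerN scalerA.
  have -> : Complex 0 (- 1) * Complex 0 1 = 1 :> R[i].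
    by apply/eqP; rewrite eq_complex /= !mul0r mulr1 mulr0 !(mulN1r, opprK, sub0r, addr0) !eqxx.
  rewrite scale1r => ->; rewrite -scaleNr; congr (_ *: _).
  by apply/eqP; rewrite eq_complex /= !mul0r !mulr0 mulN1r !(subr0, add0r, opprK, oppr0, addr0) !eqxx.
split => //.
have cE : char_poly (map_mx rc A) = map_poly (@conjc R) (char_poly (map_mx rc A)).
  rewrite map_char_poly; congr char_poly; apply/matrixP => u v.
  by rewrite !mxE; apply/eqP; rewrite eq_complex /= oppr0 !eqxx.
by rewrite cE complex_root_conj /= opprK.
Qed.

End Hermitian.

(** * Weighted matching matrices and their squares *)

Section MatchingMatrix.
Variables (R : realType) (n k : nat) (a b : 'I_k -> 'I_n).
Hypothesis a_inj : injective a.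
Hypothesis b_inj : injective b.
Hypothesis ab : forall m m', a m != b m'.

Definition edge_mx (u v : 'I_n) : 'M[R]_n := delta_mx u v - delta_mx v u.

Lemma tr_edge_mx u v : (edge_mx u v)^T = - edge_mx u v.
Proof. by rewrite /edge_mx linearB /= !trmx_delta opprB. Qed.

Definition matching_mx (t : 'I_k -> R) := \sum_m t m *: edge_mx (a m) (b m).

Lemma tr_matching_mx t : (matching_mx t)^T = - matching_mx t.
Proof.
rewrite /matching_mx linear_sum -sumrN; apply: eq_bigr => m _.
by rewrite linearZ /= tr_edge_mx scalerN.
Qed.

Lemma mul_edge_mx m m' : edge_mx (a m) (b m) *m edge_mx (a m') (b m') =
  (- (delta_mx (a m) (a m) + delta_mx (b m) (b m))) *+ (m == m').
Proof.
rewrite /edge_mx mulmxBl !mulmxBr !mul_delta_mx_cond.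
rewrite (inj_eq a_inj) (inj_eq b_inj) [b m == a m']eq_sym !(negPf (ab _ _)).
rewrite !mulr0n sub0r subr0.
by have [->|_] := eqVneq m m'; rewrite ?mulr1n ?mulr0n ?subr0 ?oppr0 // opprD.
Qed.

(** The diagonal of minus the square of [matching_mx t]: both endpoints of edge [m] carry
    [t m ^+ 2], unmatched vertices carry 0. *)
Definition matching_diag (t : 'I_k -> R) (u : 'I_n) :=
  \sum_m t m ^+ 2 * ((u == a m)%:R + (u == b m)%:R).

Lemma matching_mx_sqr mu t : (mu ^+ 2)%:M + matching_mx t *m matching_mx t =
  diag_mx (\row_u (mu ^+ 2 - matching_diag t u)).
Proof.
have -> : matching_mx t *m matching_mx t =
    \sum_m t m ^+ 2 *: - (delta_mx (a m) (a m) + delta_mx (b m) (b m)).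
  rewrite /matching_mx mulmx_suml; apply: eq_bigr => m _.
  rewrite mulmx_sumr (bigD1 m) //= big1 ?addr0 => [|m' m'm].
    by rewrite -scalemxAl -scalemxAr scalerA mul_edge_mx eqxx mulr1n.
  by rewrite -scalemxAl -scalemxAr mul_edge_mx eq_sym (negPf m'm) mulr0n !scaler0.
apply/matrixP => u v; rewrite !mxE summxE /matching_diag.
rewrite mulrnBl; congr (_ + _).
rewrite -mulNrn -sumrN -sumrMnl; apply: eq_bigr => m _; rewrite !mxE.
have [<-|uv] := eqVneq u v; first by rewrite !andbb mulr1n mulrN.
case: (eqVneq u (a m)) => [<-|_]; case: (eqVneq u (b m)) => [<-|_];
  by rewrite ?[v == u]eq_sym ?(negPf uv) ?addr0 ?mulr0n ?oppr0 ?mulr0.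
Qed.

Lemma matching_diag_a t m : matching_diag t (a m) = t m ^+ 2.
Proof.
rewrite /matching_diag (bigD1 m) //= eqxx (negPf (ab _ _)) addr0 mulr1.
rewrite big1 ?addr0 // => m' m'm.
by rewrite (inj_eq a_inj) eq_sym (negPf m'm) (negPf (ab _ _)) addr0 mulr0.
Qed.

Lemma matching_diag_b t m : matching_diag t (b m) = t m ^+ 2.
Proof.
rewrite /matching_diag (bigD1 m) //= eqxx eq_sym (negPf (ab _ _)) add0r mulr1.
rewrite big1 ?addr0 // => m' m'm.
by rewrite (inj_eq b_inj) eq_sym [m == m']eq_sym (negPf m'm) (negPf (ab _ _)) addr0 mulr0.
Qed.

Lemma matching_diag_out t u : (forall m, u != a m) -> (forall m, u != b m) ->
  matching_diag t u = 0.
Proof.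
move=> ua ub; rewrite /matching_diag big1 // => m _.
by rewrite (negPf (ua m)) (negPf (ub m)) addr0 mulr0.
Qed.

Lemma det_matching_sqr mu t :
  \det ((mu ^+ 2)%:M + matching_mx t *m matching_mx t) =
  \prod_u (mu ^+ 2 - matching_diag t u).
Proof.
by rewrite matching_mx_sqr det_diag; apply: eq_bigr => u _; rewrite mxE.
Qed.

End MatchingMatrix.

(** * Perturbing the matching matrix while keeping prescribed eigenvalues *)

Lemma skew_spectral_weights (R : realType) n k (a b : 'I_k -> 'I_n)
    (C : 'M[R]_n) (mu : 'I_k -> R) :
  injective a -> injective b -> (forall m m', a m != b m') -> C^T = - C ->
  injective mu -> (forall m, 0 < mu m) ->
  exists (eps : R) (t : 'I_k -> R), [/\ eps != 0, forall m, t m != 0 & forall j,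
    complex.Re (\det (herm_mx (mu j) (eps *: C + matching_mx a b t))) = 0].
Proof.
move=> a_inj b_inj ab skC mu_inj mu0.
(* Coordinate 0 of [x] is the factor of [C]; the lifted coordinates are the matching weights. *)
pose w (x : 'rV[R]_k.+1) (m : 'I_k) := x 0 (lift ord0 m).
pose A (x : 'rV[R]_k.+1) := x 0 ord0 *: C + matching_mx a b (w x).
have skA x : (A x)^T = - A x.
  by rewrite linearD /= linearZ /= skC tr_matching_mx scalerN opprD.
pose f j x := complex.Re (\det (herm_mx (mu j) (A x))).
have hf j : hadamard (f j).
  have [] // : hadamardc (fun x => \det (herm_mx (mu j) (A x))).
  apply: hadamardc_det => u v; split.
    under [X in hadamard X]funext do rewrite herm_mxE /=; exact: hadamard_cst.
  under [X in hadamard X]funext do rewrite herm_mxE /=.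
  apply: (@hadamard_lin _ _ _ _ (fun l => if unlift ord0 l is Some m
    then edge_mx R (a m) (b m) else C)) => x.
  rewrite big_ord_recl unlift_none; congr (_ + _).
  by apply: eq_bigr => m _; rewrite liftK.
have /fin_all_exists [phi phiP] : forall j, exists phi : 'I_k.+1 -> 'rV[R]_k.+1 * 'rV[R]_k.+1 -> R,
    (forall m, continuous (phi m)) /\
    (forall x y, f j x - f j y = \sum_m phi m (x, y) * (x 0 m - y 0 m)).
  by move=> j; have [_ [phi ? ?]] := hf j; exists phi.
pose p : 'rV[R]_k.+1 := \row_l (if unlift ord0 l is Some m then mu m else 0).
have p0 : p 0 ord0 = 0 by rewrite mxE unlift_none.
have pS m : p 0 (lift ord0 m) = mu m by rewrite mxE liftK.
have fsqr j (x : 'rV[R]_k.+1) : x 0 ord0 = 0 ->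
    f j x ^+ 2 = \prod_u (mu j ^+ 2 - matching_diag a b (w x) u).
  move=> x0; rewrite /f det_herm_sqr // /A x0 scale0r add0r.
  exact: det_matching_sqr.
(* When coordinate 0 vanishes, weight [j] alone makes equation [j] hold, whatever the other weights
   are. This is why the Jacobian is diagonal. *)
have f0 j (x : 'rV[R]_k.+1) : x 0 ord0 = 0 -> w x j = mu j -> f j x = 0.
  move=> x0 xj; apply/eqP; rewrite -sqrf_eq0 fsqr // (bigD1 (a j)) //=.
  by rewrite matching_diag_a // xj subrr mul0r.
have fp j : f j p = 0 by apply: f0; rewrite // /w pS.
(* The part of the product not coming from the endpoints of edge [j]. Other edges contribute
   differences of squares of distinct positive numbers, unmatched vertices [mu j ^+ 2]. *)
pose rest j := \prod_(u | (u != a j) && (u != b j))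
  (mu j ^+ 2 - matching_diag a b mu u).
have rest0 j : rest j != 0.
  apply/prodf_neq0 => u /andP [ua ub]; rewrite subr_eq0.
  have mu_sqr m : m != j -> mu j ^+ 2 != mu m ^+ 2.
    move=> mj; rewrite eqrXn2 ?ltW //; apply: contra mj => /eqP/mu_inj ->.
    exact: eqxx.
  case: (pickP (fun m => u == a m)) => [m /eqP um|na].
    rewrite um matching_diag_a // mu_sqr //.
    by apply: contraNneq ua => <-; rewrite um.
  case: (pickP (fun m => u == b m)) => [m /eqP um|nb].
    rewrite um matching_diag_b // mu_sqr //.
    by apply: contraNneq ub => <-; rewrite um.
  rewrite matching_diag_out ?sqrf_eq0 ?gt_eqF // => m; first by rewrite na.
  by rewrite nb.
have line0 j (h : R) : (p + h *: delta_mx 0 (lift ord0 j)) 0 ord0 = 0.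
  by rewrite !mxE unlift_none andbF mulr0 addr0.
have lineS j m (h : R) : w (p + h *: delta_mx 0 (lift ord0 j)) m =
    mu m + h * (m == j)%:R.
  by rewrite /w !mxE liftK (inj_eq lift_inj).
have slope j m : phi j (lift ord0 m) (p, p) ^+ 2 =
    if m == j then (2 * mu j) ^+ 2 * rest j else 0.
  have [cphi fE] := phiP j.
  have [->|mj] := eqVneq m j; last first.
    apply: (@hadamard_sqr_slope _ _ (f j) (phi j) p (lift ord0 m) (fun=> 0)) => //.
      exact: cst_continuous.
    move=> h; rewrite mulr0; apply/eqP; rewrite sqrf_eq0; apply/eqP/f0 => //.
    by rewrite lineS eq_sym (negPf mj) mulr0 addr0.
  rewrite -[2 * mu j]addr0.
  apply: (@hadamard_sqr_slope _ _ (f j) (phi j) p (lift ord0 j)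
    (fun h => (2 * mu j + h) ^+ 2 * rest j)) => //.
    have cl : (2 * mu j + h) @[h --> (0 : R)] --> 2 * mu j + 0.
      by apply: cvgD; [exact: cvg_cst|exact: cvg_id].
    exact: (cvgM (cvgM cl cl) (cvg_cst _)).
  (* Each endpoint of edge [j] contributes [- h * (2 * mu j + h)], whence the factor [h ^+ 2]; the
     other vertices do not involve weight [j]. *)
  move=> h; rewrite fsqr // (bigD1 (a j)) //= (bigD1 (b j)) /=; last first.
    by rewrite eq_sym.
  rewrite matching_diag_a // matching_diag_b // lineS eqxx mulr1.
  rewrite (eq_bigr (fun u => mu j ^+ 2 - matching_diag a b mu u)); last first.
    move=> u /andP [ua ub]; congr (_ - _); apply: eq_bigr => l _.
    rewrite lineS; have [->|_] := eqVneq l j; last by rewrite mulr0 addr0.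
    by rewrite (negPf ua) (negPf ub) addr0 !mulr0.
  rewrite -/(rest j); ring.
pose c j := phi j (lift ord0 j) (p, p).
have c0 j : c j != 0.
  rewrite -sqrf_eq0 slope eqxx mulf_neq0 // expf_neq0 // mulf_neq0 ?gt_eqF //.
(* The radius [s^-1] lies below every [mu m], so weights this close to [mu] stay nonzero; the added
   1 keeps [s] positive when [k] is 0. *)
pose s : R := \sum_m (mu m)^-1 + 1.
have s0 : 0 < s by rewrite ltr_wpDl // sumr_ge0 // => m _; rewrite invr_ge0 ltW.
have smu m : s^-1 < mu m.
  rewrite -[mu m]invrK ltf_pV2 ?posrE ?invr_gt0 // /s (bigD1 m) //= -addrA ltrDl.
  by rewrite ltr_wpDl // sumr_ge0 // => i _; rewrite invr_ge0 ltW.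
have [||||||x [xp x0 fx]] := @hadamard_solve R k f phi p c s^-1.
- by move=> j; have [] := phiP j.
- by move=> j; have [] := phiP j.
- exact: fp.
- exact: c0.
- move=> j m; have [->|mj] := eqVneq m j; first by rewrite mulr1.
  by apply/eqP; rewrite mulr0 -sqrf_eq0 slope (negPf mj).
- by rewrite invr_gt0.
exists (x 0 ord0), (w x); split; first by rewrite -p0.
  move=> m; apply: contraTneq (xp (lift ord0 m)) => wm0.
  by rewrite -ltNge -/(w x m) wm0 pS sub0r normrN gtr0_norm.
exact: fx.
Qed.

Lemma skew_class_spectrum (R : realType) n (e : rel 'I_n)
    (mu : 'I_(matching_number e) -> R) :
  simple_graph e -> injective mu -> (forall m, 0 < mu m) ->
  exists2 A : 'M[R]_n, skew_class e A &
    forall m, Complex 0 (mu m) \in eigenvalues A /\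
              Complex 0 (- mu m) \in eigenvalues A.
Proof.
move=> [e_sym e_irr] mu_inj mu0.
have [a [b [a_inj b_inj ab eab]]] := matching_enum e_irr.
pose matched u v := [exists m, (u == a m) && (v == b m) || (u == b m) && (v == a m)].
have matched_sym u v : matched u v = matched v u.
  by apply: eq_existsb => m; rewrite orbC andbC [X in _ || X]andbC.
(* Signs follow the order of the vertices to make [C] skew. Its support avoids the matching, so
   nothing cancels in the sum and nonzero [eps] and [t] give exactly the pattern of [e]. *)
pose C : 'M[R]_n := \matrix_(u, v)
  (if e u v && ~~ matched u v then (if (u < v)%N then 1 else -1) else 0).
have skC : C^T = - C.
  apply/matrixP => u v; rewrite !mxE e_sym matched_sym.
  case: ifPn => [/andP [euv _]|_]; last by rewrite oppr0.
  by case: ltngtP => [||/val_inj uv]; rewrite ?opprK // uv e_irr in euv *.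
have [eps [t [eps0 t0 detA]]] :=
  skew_spectral_weights a_inj b_inj ab skC mu_inj mu0.
have skA : (eps *: C + matching_mx a b t)^T = - (eps *: C + matching_mx a b t).
  by rewrite linearD /= linearZ /= skC tr_matching_mx scalerN opprD.
have matchE u v : matching_mx a b t u v = \sum_m t m *
    (((u == a m) && (v == b m))%:R - ((u == b m) && (v == a m))%:R).
  by rewrite summxE; apply: eq_bigr => m _; rewrite !mxE.
have matchN u v : ~~ matched u v -> matching_mx a b t u v = 0.
  rewrite negb_exists => /forallP nm; rewrite matchE big1 // => m _.
  by have := nm m; rewrite negb_or => /andP [/negPf -> /negPf ->]; rewrite subrr mulr0.
have matchY u v : matched u v -> matching_mx a b t u v != 0 /\ e u v.
  have at_ab m : matching_mx a b t (a m) (b m) = t m.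
    rewrite matchE (bigD1 m) //= !eqxx (negPf (ab _ _)) subr0 mulr1 big1 ?addr0 //.
    move=> m' m'm; rewrite (inj_eq a_inj) eq_sym (negPf m'm) (negPf (ab _ _)).
    by rewrite subrr mulr0.
  case/existsP => m /orP [] /andP [/eqP -> /eqP ->].
    by rewrite at_ab t0 eab.
  by rewrite (skewE (tr_matching_mx a b t)) oppr_eq0 at_ab t0 e_sym eab.
exists (eps *: C + matching_mx a b t); last first.
  by move=> m; rewrite !mem_eigenvalues; apply: det_herm_root.
split=> // u v uv; rewrite 3!mxE.
have [muv|muv] := boolP (matched u v).
  by rewrite andbF mulr0 add0r; have [-> ->] := matchY _ _ muv.
rewrite matchN // addr0 andbT mulf_eq0 negb_or eps0 /=.
case: (e u v); last by rewrite eqxx.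
by case: ifP => _; rewrite ?oppr_eq0 oner_eq0.
Qed.

(** * Spectra made of opposite pairs, and the equivalence *)

Lemma uniq_opp_pairs (R : realType) k (mu : 'I_k -> R) : injective mu ->
  (forall m, 0 < mu m) ->
  uniq ([seq Complex 0 (mu i) | i <- enum 'I_k] ++
        [seq Complex 0 (- mu i) | i <- enum 'I_k]).
Proof.
move=> mu_inj mu0.
have pos_inj : injective (fun i => Complex 0 (mu i)) by move=> i j [] /mu_inj.
have neg_inj : injective (fun i => Complex 0 (- mu i)).
  by move=> i j [] /oppr_inj /mu_inj.
rewrite cat_uniq (map_inj_uniq pos_inj) (map_inj_uniq neg_inj) enum_uniq andbT.
apply/hasPn => z /mapP [i _ ->]; apply/mapP => -[j _ []] E.
by have := mu0 j; rewrite -E oppr_gt0 ltNge ltW.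
Qed.

Lemma skew_class_opp_pairs (R : realType) n (e : rel 'I_n)
    (mu : 'I_(matching_number e) -> R) :
  simple_graph e -> injective mu -> (forall m, 0 < mu m) ->
  exists2 A : 'M[R]_n, skew_class e A &
    perm_eq (eigenvalues A)
      ([seq Complex 0 (mu i) | i <- enum 'I_(matching_number e)] ++
       [seq Complex 0 (- mu i) | i <- enum 'I_(matching_number e)] ++
       nseq (n - 2 * matching_number e)%N 0).
Proof.
move=> simple mu_inj mu0.
have [A Ae specA] := skew_class_spectrum simple mu_inj mu0.
exists A => //; rewrite catA.
set s := (X in X ++ nseq _ _).
have szs : size s = (2 * matching_number e)%N.
  by rewrite size_cat !(size_map _ (enum 'I_(matching_number e))) size_enum_ord addnn mul2n.
rewrite -szs; apply: perm_eigenvalues.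
- exact: uniq_opp_pairs.
- rewrite mem_cat; apply/norP; split; apply/mapP => -[i _ [] /eqP].
    by rewrite eq_sym gt_eqF.
  by rewrite eq_sym oppr_eq0 gt_eqF.
- by move=> z; rewrite mem_cat => /orP [] /mapP [i _ ->]; case: (specA i).
- by rewrite szs; apply: skew_rank_le_matching; [case: Ae|apply: skew_class_supp].
Qed.

Lemma count_neq0_opp_pairs (R : realType) k r (mu : 'I_k -> R) :
  (forall m, 0 < mu m) ->
  count (fun z : R[i] => z != 0)
    ([seq Complex 0 (mu i) | i <- enum 'I_k] ++
     [seq Complex 0 (- mu i) | i <- enum 'I_k] ++ nseq r 0) = (2 * k)%N.
Proof.
move=> mu0; rewrite !count_cat count_nseq eqxx mul0n addn0 !(count_map _ _ (enum 'I_k)).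
rewrite !(eq_in_count (a2 := predT)) => [|i _|i _].
- by rewrite count_predT size_enum_ord addnn mul2n.
- by apply/eqP => -[] /eqP; rewrite oppr_eq0 gt_eqF.
- by apply/eqP => -[] /eqP; rewrite gt_eqF.
Qed.

Theorem theorem3p6 (R : realType) (n k : nat) (e : rel 'I_n)
    (lam : 'I_k -> R[i]) :
  simple_graph e ->
  (2 * k <= n)%N ->
  (forall i : 'I_k, complex.Re (lam i) = 0) ->
  (forall i j : 'I_k, (i < j)%N -> complex.Im (lam j) < complex.Im (lam i)) ->
  (forall i : 'I_k, 0 < complex.Im (lam i)) ->
  (matching_number e = k <->
    (exists A : 'M[R]_n, skew_class e A /\
       perm_eq (eigenvalues A)
         ([seq lam i | i <- enum 'I_k] ++ [seq - lam i | i <- enum 'I_k]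
            ++ nseq (n - 2 * k)%N 0)) /\
    (forall A : 'M[R]_n, skew_class e A ->
       (count (fun z : R[i] => z != 0%R) (eigenvalues A) <= 2 * k)%N)).
Proof.
move=> simple _ re0 im_lt im0.
pose mu i := complex.Im (lam i).
have lamE : [seq lam i | i <- enum 'I_k] = [seq Complex 0 (mu i) | i <- enum 'I_k].
  by apply: eq_map => i; have := re0 i; rewrite /mu; case: (lam i) => x y /= ->.
have lamNE :
    [seq - lam i | i <- enum 'I_k] = [seq Complex 0 (- mu i) | i <- enum 'I_k].
  apply: eq_map => i; have := re0 i; rewrite /mu; case: (lam i) => x y /= ->.
  by apply/eqP; rewrite eq_complex /= oppr0 !eqxx.
have mu_inj : injective mu.
  move=> i j mu_ij; apply/val_inj; case: (ltngtP i j) => // /im_lt.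
    by rewrite -/(mu i) -/(mu j) mu_ij ltxx.
  by rewrite -/(mu i) -/(mu j) mu_ij ltxx.
rewrite lamE lamNE; split=> [ke|[[A [Ae permA]] maxk]].
  split=> [|A /count_neq0_eigenvalues_matching]; last by rewrite ke.
  have mu0 : forall i, 0 < mu i := im0.
  (* Only [mu] is kept from [lam], so that [k] can be replaced by the matching number in its index
     type. *)
  clearbody mu; clear -ke simple mu_inj mu0; subst k.
  by have [A] := skew_class_opp_pairs simple mu_inj mu0; exists A.
apply/eqP; rewrite -(eqn_pmul2l (isT : 0 < 2)%N) eqn_leq; apply/andP; split.
  (* Any distinct positive values serve here: they yield a matrix of the class with
     [2 * matching_number e] nonzero eigenvalues, to which condition (b) applies. *)
  pose nu (i : 'I_(matching_number e)) : R := i.+1%:R.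
  have nu0 i : 0 < nu i by [].
  have nu_inj : injective nu.
    by move=> i j /eqP; rewrite eqr_nat eqSS => /eqP/val_inj.
  have [B Be /permP permB] := skew_class_opp_pairs simple nu_inj nu0.
  by apply: leq_trans (maxk B Be); rewrite permB count_neq0_opp_pairs.
(* The matrix from condition (a) has exactly [2 * k] nonzero eigenvalues, which gives the reverse
   inequality. *)
have := count_neq0_eigenvalues_matching Ae.
by move/permP: permA => ->; rewrite count_neq0_opp_pairs.
Qed.
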